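(* Let $R$ be the pullback ring of ring epimorphisms $R_1\xrightarrow{v_1}\overline R\xleftarrow{v_2}R_2$. Every $R$-submodule of a separated $R$-module is again separated. In particular, for an $R$-linear map $f\colon M\to N$ of $R$-modules: if $M$ is separated, then $\ker f$ is separated; and if $N$ is separated, then $\operatorname{im} f$ is separated.
   Context: Rings are unital and modules are (left) modules. $v_1,v_2$ are surjective ring homomorphisms, $R=\{(r_1,r_2)\in R_1\oplus R_2: v_1(r_1)=v_2(r_2)\}$, and $P_i=\ker v_i$. Any $\overline R$-module is an $R_i$-module via $v_i$. Given $R_i$-modules $S_i$ ($i=1,2$), an $\overline R$-module $\overline S$ and $R_i$-linear maps $p_i\colon S_i\to\overline S$, the pullback $S=\{(s_1,s_2): p_1(s_1)=p_2(s_2)\}$ is an $R$-module by $(r_1,r_2)(s_1,s_2)=(r_1s_1,r_2s_2)$; it is called a pullback module with pullback diagram $S_1\xrightarrow{p_1}\overline S\xleftarrow{p_2}S_2$. The diagram is separated if each $p_i$ is surjective and $\ker p_i=P_iS_i$; an $R$-module is separated if it is (isomorphic to) the pullback of a separated diagram. *)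

(* Defs.v *)
From HB Require Import structures.
From mathcomp Require Import all_boot all_order all_algebra.
From mathcomp Require Import all_classical.

Set Implicit Arguments.
Unset Strict Implicit.
Unset Printing Implicit Defensive.

Import GRing.Theory.
Local Open Scope ring_scope.

(* Rings are [pzRingType]s: unital, not assumed commutative, and possibly     *)
(* zero. Modules are left modules.                                            *)

Section PullbackRing.
Variables (R1 R2 Rbar : pzRingType).
Variables (v1 : {rmorphism R1 -> Rbar}) (v2 : {rmorphism R2 -> Rbar}).

Definition pullback_ring_pred : {pred R1 * R2} :=
  [pred r | v1 r.1 == v2 r.2].

Fact pullback_ring_subring : subring_closed pullback_ring_pred.
Proof.
split=> [|x y|x y]; rewrite !inE /= ?rmorph1 //.
- by move=> /eqP ex /eqP ey; rewrite !rmorphB ex ey.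
- by move=> /eqP ex /eqP ey; rewrite !rmorphM ex ey.
Qed.

Record pullback_ring : Type := PullbackRing {
  pullback_ring_val : R1 * R2;
  _ : pullback_ring_val \in pullback_ring_pred
}.
HB.instance Definition _ := [isSub for pullback_ring_val].
HB.instance Definition _ := [Choice of pullback_ring by <:].
HB.instance Definition _ := GRing.SubChoice_isSubPzRing.Build
  (R1 * R2)%type pullback_ring_pred pullback_ring pullback_ring_subring.

End PullbackRing.

(* A map [p : S -> Sbar] which is R_i-linear, with Sbar seen as an R_i-module *)
(* via v_i, is a [{linear S -> Sbar | v_i \; *:%R}].                          *)
Section PullbackModule.
Variables (R1 R2 Rbar : pzRingType).
Variables (v1 : {rmorphism R1 -> Rbar}) (v2 : {rmorphism R2 -> Rbar}).
Variables (S1 : lmodType R1) (S2 : lmodType R2) (Sbar : lmodType Rbar).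
Variables (p1 : {linear S1 -> Sbar | v1 \; *:%R}).
Variables (p2 : {linear S2 -> Sbar | v2 \; *:%R}).
Local Notation R := (pullback_ring v1 v2).

Definition pullback_mod_pred : {pred S1 * S2} :=
  [pred s | p1 s.1 == p2 s.2].

Fact pullback_mod_zmod : zmod_closed pullback_mod_pred.
Proof.
split=> [|x y]; rewrite !inE /= ?raddf0 //.
by move=> /eqP ex /eqP ey; rewrite 2!linearB /= ex ey.
Qed.

Record pullback_mod : Type := PullbackMod {
  pullback_mod_val : S1 * S2;
  _ : pullback_mod_val \in pullback_mod_pred
}.
HB.instance Definition _ := [isSub for pullback_mod_val].
HB.instance Definition _ := [Choice of pullback_mod by <:].
HB.instance Definition _ := GRing.SubChoice_isSubZmodule.Build
  (S1 * S2)%type pullback_mod_pred pullback_mod pullback_mod_zmod.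

Definition pullback_scale_val (r : R) (s : pullback_mod) : S1 * S2 :=
  ((val r).1 *: (val s).1, (val r).2 *: (val s).2).

Fact pullback_scale_subproof r s :
  pullback_scale_val r s \in pullback_mod_pred.
Proof.
rewrite inE /= !linearZ_LR /=.
by have /eqP-> := valP r; have /eqP-> := valP s.
Qed.

Definition pullback_scale (r : R) (s : pullback_mod) : pullback_mod :=
  Sub (pullback_scale_val r s) (pullback_scale_subproof r s).

Fact pullback_scaleA a b s :
  pullback_scale a (pullback_scale b s) = pullback_scale (a * b) s.
Proof. by apply: val_inj; congr pair => /=; rewrite scalerA. Qed.

Fact pullback_scale1 : left_id 1 pullback_scale.
Proof.
move=> s; apply: val_inj; rewrite /= /pullback_scale_val /= !scale1r.
by case: (val s).
Qed.

Fact pullback_scaleDr : right_distributive pullback_scale +%R.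
Proof. by move=> a s t; apply: val_inj; congr pair => /=; rewrite scalerDr. Qed.

Fact pullback_scaleDl s :
  {morph pullback_scale^~ s : a b / a + b}.
Proof. by move=> a b; apply: val_inj; congr pair => /=; rewrite scalerDl. Qed.

HB.instance Definition _ := GRing.Zmodule_isLmodule.Build R pullback_mod
  pullback_scaleA pullback_scale1 pullback_scaleDr pullback_scaleDl.

End PullbackModule.

(* [x \in P S] for P the kernel of v: finite sums of products.                *)
Definition ker_mul (R Rbar : pzRingType) (v : {rmorphism R -> Rbar})
    (S : lmodType R) (x : S) : Prop :=
  exists (n : nat) (r : 'I_n -> R) (s : 'I_n -> S),
    (forall i, v (r i) = 0) /\ x = \sum_(i < n) r i *: s i.

Definition surjective (A B : Type) (f : A -> B) : Prop :=
  forall y, exists x, f x = y.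

Section Separated.
Variables (R1 R2 Rbar : pzRingType).
Variables (v1 : {rmorphism R1 -> Rbar}) (v2 : {rmorphism R2 -> Rbar}).

Definition separated_diagram (S1 : lmodType R1) (S2 : lmodType R2)
    (Sbar : lmodType Rbar)
    (p1 : {linear S1 -> Sbar | v1 \; *:%R})
    (p2 : {linear S2 -> Sbar | v2 \; *:%R}) : Prop :=
  [/\ surjective p1, surjective p2,
      (forall x, p1 x = 0 <-> ker_mul v1 x) &
      (forall x, p2 x = 0 <-> ker_mul v2 x)].

Definition separated (M : lmodType (pullback_ring v1 v2)) : Prop :=
  exists (S1 : lmodType R1) (S2 : lmodType R2) (Sbar : lmodType Rbar)
         (p1 : {linear S1 -> Sbar | v1 \; *:%R})
         (p2 : {linear S2 -> Sbar | v2 \; *:%R}),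
    separated_diagram p1 p2 /\
    exists phi : {linear M -> pullback_mod p1 p2}, bijective phi.

End Separated.

(* Boolean predicates capture all submodules, since the development is        *)
(* classical: any [P : M -> Prop] is the predicate [fun x => `[< P x >]].     *)
Section Submodule.
Variables (R : pzRingType) (M : lmodType R) (U : submodClosed M).

Record submod : Type := Submod { submod_val : M; _ : submod_val \in U }.
HB.instance Definition _ := [isSub for submod_val].
HB.instance Definition _ := [Choice of submod by <:].
HB.instance Definition _ := [SubChoice_isSubLmodule of submod by <:].

End Submodule.

Section KerIm.
Variables (R : pzRingType) (M N : lmodType R) (f : {linear M -> N}).

Definition ker_lin : {pred M} := [pred x | f x == 0].
Definition im_lin : {pred N} := [pred y | `[< exists x, f x = y >]].

Fact ker_lin_submod : submod_closed ker_lin.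
Proof.
split=> [|a x y]; rewrite !inE ?linear0 // => /eqP fx /eqP fy.
by rewrite linearP fx fy scaler0 addr0.
Qed.

Fact im_lin_submod : submod_closed im_lin.
Proof.
split=> [|a y z]; first by apply/asboolP; exists 0; rewrite linear0.
move=> /asboolP[x <-] /asboolP[x' <-]; apply/asboolP.
by exists (a *: x + x'); rewrite linearP.
Qed.

HB.instance Definition _ := GRing.isSubmodClosed.Build R M ker_lin ker_lin_submod.
HB.instance Definition _ := GRing.isSubmodClosed.Build R N im_lin im_lin_submod.

End KerIm.

(* Main.v *)
Require Import Defs.
From mathcomp Require Import all_boot all_order all_algebra.
From HB Require Import structures.
From mathcomp Require Import boolp.

(** Separatedness can be tested inside the module, by a condition that passes
    to submodules: [M] is separated if and only if [P1 M] and [P2 M] meet only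
    in 0, where [P1] and [P2] are seen as the ideals [P1 (+) 0] and
    [0 (+) P2] of [R], the kernels of the projections [R -> R2] and [R -> R1]
    respectively. Since [P1 U] and [P2 U] lie in [P1 M] and [P2 M] for every
    submodule [U] of [M], the condition for [M] gives it for [U]; kernels and
    images are instances.

    If [M] is the pullback of [S1] and [S2], then elements of [P1 M] vanish in
    [S2] and elements of [P2 M] vanish in [S1], so an element of both is 0
    ([separated_cap0]).

    Conversely, suppose that the intersection is 0 and consider the diagram
    [M / P2 M -> M / (P1 M + P2 M) <- M / P1 M] ([cap0_separated]). The kernel
    of its first map is [(P1 M + P2 M) / P2 M], that is [P1 (M / P2 M)], and
    symmetrically for the second, so the diagram is separated. The map from
    [M] to its pullback is injective by hypothesis. It is surjective because,
    when [x] and [y] agree modulo [P1 M + P2 M], say [x - y = z1 + z2], the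
    element [y + z1 = x - z2] has the class of [x] modulo [P2 M] and that of
    [y] modulo [P1 M].

    The three quotients are all of the form [M / (ker q) M], the base change of
    [M] along a surjective morphism [q] from [R] to [R1], [R2] or [Rbar], and
    both maps of the diagram are the transition maps between base changes
    ([bc_map], [bc_map_eq0]).

    The diagram formed by the images of [U] in [S1] and [S2] would not do: if
    [U] is [P1 S1] inside [S1], its image in [S2] is 0, which forces the
    central module to be 0 while [P1 U] may be smaller than [U]. *)

Set Implicit Arguments.
Unset Strict Implicit.
Unset Printing Implicit Defensive.

Import GRing.Theory.
Local Open Scope ring_scope.
Local Open Scope quotient_scope.

(** * The submodule generated by the kernel of a ring morphism *)

Section KerMul.
Variables (R A : pzRingType) (q : {rmorphism R -> A}).

Lemma ker_mulZ (M : lmodType R) r (x : M) : q r = 0 -> ker_mul q (r *: x).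
Proof.
by move=> qr; exists 1, (fun=> r), (fun=> x); split=> //; rewrite big_ord1.
Qed.

Lemma ker_mul0 (M : lmodType R) : ker_mul q (0 : M).
Proof. by rewrite -(scale0r 0); apply: ker_mulZ; rewrite rmorph0. Qed.

Lemma ker_mulD (M : lmodType R) (x y : M) :
  ker_mul q x -> ker_mul q y -> ker_mul q (x + y).
Proof.
move=> [n [r [s [qr ->]]]] [m [r' [s' [qr' ->]]]].
exists (n + m), (fun i => match split i with inl j => r j | inr j => r' j end).
exists (fun i => match split i with inl j => s j | inr j => s' j end).
split=> [i|]; first by case: (split i).
rewrite big_split_ord /=; congr (_ + _); apply: eq_bigr => i _.
- by case: split_ordP => j /eqP; rewrite ?eq_lshift ?eq_lrshift // => /eqP->.
- by case: split_ordP => j /eqP; rewrite ?eq_rshift ?eq_rlshift // => /eqP->.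
Qed.

Definition ker_mul_pred (M : lmodType R) : {pred M} :=
  [pred x | `[< ker_mul q x >]].
Arguments ker_mul_pred : clear implicits.

(** Left multiples of [r] stay in the kernel because [q (a * r) = q a * q r]. *)
Fact ker_mul_submod (M : lmodType R) : submod_closed (ker_mul_pred M).
Proof.
split=> [|a x y]; first exact/asboolP/ker_mul0.
move=> /asboolP[n [r [s [qr ->]]]] /asboolP qy; apply/asboolP/ker_mulD => //.
exists n, (fun i => a * r i), s; split=> [i|].
  by rewrite rmorphM qr mulr0.
by rewrite scaler_sumr; apply: eq_bigr => i _; rewrite scalerA.
Qed.

HB.instance Definition _ M :=
  GRing.isSubmodClosed.Build R M (ker_mul_pred M) (ker_mul_submod M).

Lemma ker_mul_linear (M N : lmodType R) (f : {linear M -> N}) x :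
  ker_mul q x -> ker_mul q (f x).
Proof.
move=> [n [r [s [qr ->]]]]; exists n, r, (f \o s); split=> //.
by rewrite linear_sum; apply: eq_bigr => i _; rewrite linearZ.
Qed.

(** A semilinear map from [M] to an [A]-module factors through
    [M / (ker q) M]. *)
Lemma ker_mul_semilinear0 (M : lmodType R) (N : lmodType A)
    (f : {linear M -> N | q \; *:%R}) x :
  ker_mul q x -> f x = 0.
Proof.
move=> [n [r [s [qr ->]]]]; rewrite linear_sum big1 // => i _.
by rewrite linearZ_LR /= qr scale0r.
Qed.

End KerMul.
Arguments ker_mul_pred {R A} q M.

(** * Base change along a surjective ring morphism *)

Section BaseChange.
Variables (R A : pzRingType) (q : {rmorphism R -> A}) (q_surj : surjective q).
Variable M : lmodType R.

(** The quotient of [M] by the multiples of the kernel of [q] is the tensor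
    product of [A] with [M] over [R]; the surjectivity of [q] is recorded in
    the type since the action of [A] chooses preimages along [q]. *)
Definition base_change of surjective q := {ideal_quot (ker_mul_pred q M)}.
Local Notation AM := (base_change q_surj).

HB.instance Definition _ := GRing.Zmodule.on AM.

Definition bc (x : M) : AM := \pi_{ideal_quot (ker_mul_pred q M)} x.

Fact bc_is_zmod_morphism : zmod_morphism bc.
Proof. exact: raddfB. Qed.
HB.instance Definition _ :=
  GRing.isZmodMorphism.Build M AM bc bc_is_zmod_morphism.

Lemma bc_eq0 x : bc x = 0 <-> ker_mul q x.
Proof.
rewrite -(raddf0 bc); split=> [/eqP|qx].
  by rewrite -Quotient.idealrBE subr0 => /asboolP.
by apply/eqP; rewrite -Quotient.idealrBE subr0; apply/asboolP.
Qed.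

Lemma bc_surj : surjective bc.
Proof.
move=> u; exists (repr (u : {ideal_quot (ker_mul_pred q M)})).
exact: reprK.
Qed.

Definition bc_repr (u : AM) : M := sval (cid (bc_surj u)).
Definition ring_repr (a : A) : R := sval (cid (q_surj a)).
Definition bc_scale (a : A) (u : AM) : AM := bc (ring_repr a *: bc_repr u).

(** The action is independent of both chosen representatives: changing the
    preimage of a scalar alters the product by an element of [ker q] times
    [M], and changing the representative in [M] alters it by a multiple of an
    element of [(ker q) M]. All module axioms follow by lifting to [M]. *)
Lemma bc_scaleE r x : bc_scale (q r) (bc x) = bc (r *: x).
Proof.
rewrite /bc_scale /ring_repr /bc_repr.
case: cid => s /= qs; case: cid => y /= yx.
apply/eqP; rewrite -subr_eq0 -raddfB; apply/eqP/bc_eq0.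
rewrite -[s](subrK r) scalerDl -addrA -scalerBr.
apply: ker_mulD; first by apply: ker_mulZ; rewrite rmorphB qs subrr.
suff: r *: (y - x) \in ker_mul_pred q M by move/asboolP.
by apply: rpredZ; apply/asboolP/bc_eq0; rewrite raddfB /= yx subrr.
Qed.

Fact bc_scaleA a b u : bc_scale a (bc_scale b u) = bc_scale (a * b) u.
Proof.
have [[[r <-] [s <-]] [x <-]] := (q_surj a, q_surj b, bc_surj u).
by rewrite -rmorphM !bc_scaleE scalerA.
Qed.

Fact bc_scale1 : left_id 1 bc_scale.
Proof.
by move=> u; have [x <-] := bc_surj u; rewrite -(rmorph1 q) bc_scaleE scale1r.
Qed.

Fact bc_scaleDr : right_distributive bc_scale +%R.
Proof.
move=> a u w; have [[[r <-] [x <-]] [y <-]] := (q_surj a, bc_surj u, bc_surj w).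
by rewrite -raddfD !bc_scaleE scalerDr raddfD.
Qed.

Fact bc_scaleDl u : {morph bc_scale^~ u : a b / a + b}.
Proof.
move=> a b; have [[[r <-] [s <-]] [x <-]] := (q_surj a, q_surj b, bc_surj u).
by rewrite -rmorphD !bc_scaleE scalerDl raddfD.
Qed.

HB.instance Definition _ := GRing.Zmodule_isLmodule.Build A AM
  bc_scaleA bc_scale1 bc_scaleDr bc_scaleDl.

Fact bc_is_scalable : scalable_for (q \; *:%R) bc.
Proof. by move=> r x; rewrite -bc_scaleE. Qed.
HB.instance Definition _ :=
  GRing.isScalable.Build R M AM (q \; *:%R) bc bc_is_scalable.

Lemma bcZ r x : bc (r *: x) = q r *: bc x.
Proof. exact: linearZ_LR. Qed.

End BaseChange.
Arguments bc {R A q} q_surj {M} x.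

Section BaseChangeMap.
Variables (R A B : pzRingType).
Variables (q : {rmorphism R -> A}) (q' : {rmorphism R -> B}).
Variables (v : {rmorphism A -> B}) (vq : forall r, v (q r) = q' r).
Variables (q_surj : surjective q) (q'_surj : surjective q').
Variable M : lmodType R.

(** The identity of [M] induces a map between the base changes because
    [ker q] is contained in the kernel of [v \o q = q']. The compatibility is
    an argument so that the linear structure can be attached to [bc_map]. *)
Definition bc_map of (forall r, v (q r) = q' r) :=
  fun u : base_change M q_surj => bc q'_surj (bc_repr u).
Local Notation f := (bc_map vq).

Lemma bc_mapE x : f (bc q_surj x) = bc q'_surj x.
Proof.
rewrite /bc_map /bc_repr; case: cid => y /= yx.
apply/eqP; rewrite -subr_eq0 -raddfB; apply/eqP/bc_eq0.
have /bc_eq0[n [r [s [qr ->]]]] : bc q_surj (y - x) = 0.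
  by rewrite raddfB /= yx subrr.
by exists n, r, s; split=> // i; rewrite -vq qr rmorph0.
Qed.

Fact bc_map_is_linear : linear_for (v \; *:%R) f.
Proof.
move=> a u w.
have [[[r <-] [x <-]] [y <-]] := (q_surj a, bc_surj u, bc_surj w).
by rewrite -bcZ -raddfD !bc_mapE raddfD /= bcZ vq.
Qed.
HB.instance Definition _ := GRing.isLinear.Build A
  (base_change M q_surj) (base_change M q'_surj) (v \; *:%R) f bc_map_is_linear.

Lemma bc_map_surj : surjective f.
Proof.
move=> w; have [x <-] := bc_surj w; exists (bc q_surj x); exact: bc_mapE.
Qed.

(** An element of [ker q'] is sent by [q] into [ker v], so the kernel
    [(ker q') M / (ker q) M] is generated by the multiples of [ker v]. *)
Lemma bc_map_eq0 u : f u = 0 <-> ker_mul v u.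
Proof.
split; last exact: ker_mul_semilinear0.
have [x <-] := bc_surj u; rewrite bc_mapE => /bc_eq0[n [r [s [qr ->]]]].
exists n, (q \o r), (bc q_surj \o s); split=> [i|]; first by rewrite /= vq.
by rewrite raddf_sum; apply: eq_bigr => i _; rewrite /= bcZ.
Qed.

End BaseChangeMap.

(** * A criterion for separatedness *)

Section Criterion.
Variables (R1 R2 Rbar : pzRingType).
Variables (v1 : {rmorphism R1 -> Rbar}) (v2 : {rmorphism R2 -> Rbar}).
Local Notation R := (pullback_ring v1 v2).

Definition pull1 : {rmorphism R -> R1} := fst \o val.
Definition pull2 : {rmorphism R -> R2} := snd \o val.
Definition pull0 : {rmorphism R -> Rbar} := v1 \o pull1.

Lemma pull1K r : v1 (pull1 r) = pull0 r. Proof. by []. Qed.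

Lemma pull2K r : v2 (pull2 r) = pull0 r.
Proof. by rewrite /=; have /eqP-> := valP r. Qed.

(** The kernel of [R -> Rbar] is [P1 (+) P2]. *)
Lemma pull0_eq0 r : pull0 r = 0 ->
  exists r1 r2, [/\ pull2 r1 = 0, pull1 r2 = 0 & r = r1 + r2].
Proof.
move=> r0.
have in1 : ((val r).1, 0) \in pullback_ring_pred v1 v2.
  by rewrite inE /= rmorph0; apply/eqP.
have in2 : (0, (val r).2) \in pullback_ring_pred v1 v2.
  by rewrite inE /= rmorph0 eq_sym; apply/eqP; have := pull2K r; rewrite r0.
exists (PullbackRing in1), (PullbackRing in2); split=> //.
apply: val_inj; rewrite [LHS]surjective_pairing.
by congr pair; rewrite /= ?addr0 ?add0r.
Qed.

Lemma ker_mul_pull0 (M : lmodType R) (x : M) : ker_mul pull0 x ->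
  exists x1 x2, [/\ ker_mul pull2 x1, ker_mul pull1 x2 & x = x1 + x2].
Proof.
move=> [n [r [s [r0 ->]]]] {x}.
elim: n r s r0 => [|n IHn] r s r0.
  by rewrite big_ord0; exists 0, 0; split; rewrite ?addr0 //; exact: ker_mul0.
rewrite big_ord_recl.
have [|x1 [x2 [x1K x2K ->]]] := IHn (r \o lift ord0) (s \o lift ord0).
  by move=> i; exact: r0.
have [r1 [r2 [r1K r2K ->]]] := pull0_eq0 (r0 ord0).
exists (r1 *: s ord0 + x1), (r2 *: s ord0 + x2).
by rewrite addrACA scalerDl; split=> //; apply: ker_mulD => //; exact: ker_mulZ.
Qed.

Section PullbackModProjections.
Variables (S1 : lmodType R1) (S2 : lmodType R2) (Sbar : lmodType Rbar).
Variables (p1 : {linear S1 -> Sbar | v1 \; *:%R}).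
Variables (p2 : {linear S2 -> Sbar | v2 \; *:%R}).
Local Notation S := (pullback_mod p1 p2).

Definition pmod1 (s : S) : S1 := (val s).1.
Definition pmod2 (s : S) : S2 := (val s).2.

Fact pmod1_is_linear : linear_for (pull1 \; *:%R) pmod1.
Proof. by []. Qed.
Fact pmod2_is_linear : linear_for (pull2 \; *:%R) pmod2.
Proof. by []. Qed.

HB.instance Definition _ :=
  GRing.isLinear.Build R S S1 (pull1 \; *:%R) pmod1 pmod1_is_linear.
HB.instance Definition _ :=
  GRing.isLinear.Build R S S2 (pull2 \; *:%R) pmod2 pmod2_is_linear.

End PullbackModProjections.

(** In a pullback, scalars in the kernel of [R -> Ri] act as 0 on the [i]-th
    coordinate, so both coordinates of the image of [x] vanish. *)
Lemma separated_cap0 (M : lmodType R) (x : M) :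
  separated M -> ker_mul pull1 x -> ker_mul pull2 x -> x = 0.
Proof.
move=> [S1 [S2 [Sbar [p1 [p2 [_ [phi phi_bij]]]]]]] x1 x2.
apply: (bij_inj phi_bij); rewrite linear0; apply: val_inj.
rewrite [LHS]surjective_pairing; congr pair.
- exact: (ker_mul_semilinear0 (@pmod1 _ _ _ p1 p2)) (ker_mul_linear phi x1).
- exact: (ker_mul_semilinear0 (@pmod2 _ _ _ p1 p2)) (ker_mul_linear phi x2).
Qed.

Hypotheses (v1_surj : surjective v1) (v2_surj : surjective v2).

Lemma pull1_surj : surjective pull1.
Proof.
move=> r1; have [r2 e] := v2_surj (v1 r1).
have in12 : (r1, r2) \in pullback_ring_pred v1 v2 by rewrite inE /= e.
by exists (PullbackRing in12).
Qed.

Lemma pull2_surj : surjective pull2.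
Proof.
move=> r2; have [r1 e] := v1_surj (v2 r2).
have in12 : (r1, r2) \in pullback_ring_pred v1 v2 by rewrite inE /= e.
by exists (PullbackRing in12).
Qed.

Lemma pull0_surj : surjective pull0.
Proof.
move=> a; have [r1 <-] := v1_surj a.
by have [r <-] := pull1_surj r1; exists r.
Qed.

Section Sufficient.
Variable M : lmodType R.
Let p1 : {linear base_change M pull1_surj -> base_change M pull0_surj
          | v1 \; *:%R} := bc_map pull0_surj pull1K.
Let p2 : {linear base_change M pull2_surj -> base_change M pull0_surj
          | v2 \; *:%R} := bc_map pull0_surj pull2K.

Fact bc_pair_subproof x :
  (bc pull1_surj x, bc pull2_surj x) \in pullback_mod_pred p1 p2.
Proof. by rewrite inE /= !bc_mapE. Qed.

Definition bc_pair x : pullback_mod p1 p2 :=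
  PullbackMod (bc_pair_subproof x).

Fact bc_pair_is_linear : linear bc_pair.
Proof.
by move=> r x y; apply: val_inj; congr pair; rewrite raddfD /= bcZ.
Qed.
HB.instance Definition _ :=
  GRing.isLinear.Build R M (pullback_mod p1 p2) *:%R bc_pair bc_pair_is_linear.

(** The pullback is that of the base changes of [M] along the projections of
    [R] and along [R -> Rbar]; the diagram is separated for any [M], the
    hypothesis gives injectivity of [bc_pair], and surjectivity comes from the
    splitting of the kernel of [R -> Rbar]. *)
Lemma cap0_separated :
  (forall x : M, ker_mul pull1 x -> ker_mul pull2 x -> x = 0) -> separated M.
Proof.
move=> cap0; exists _, _, _, p1, p2; split.
  split; [exact: bc_map_surj | exact: bc_map_surj | exact: bc_map_eq0
         | exact: bc_map_eq0].
exists bc_pair.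
have inj : injective bc_pair.
  apply: raddf_inj => x /(congr1 val)[/bc_eq0 x1 /bc_eq0 x2]; exact: cap0.
have surj : forall u, exists x, bc_pair x = u.
  move=> [[a b] u_in]; have := u_in; rewrite inE /=.
  have [[x ex] [y ey]] := (bc_surj a, bc_surj b); subst a b.
  rewrite !bc_mapE -subr_eq0 -raddfB => /eqP/bc_eq0/ker_mul_pull0.
  move=> [z1 [z2 [z1K z2K exy]]]; exists (y + z1).
  apply: val_inj => /=; congr pair; last first.
    by rewrite raddfD /= (bc_eq0 _ z1).2 ?addr0.
  have -> : y + z1 = x - z2.
    by apply/eqP; rewrite eq_sym subr_eq -addrA -exy addrC subrK.
  by rewrite raddfB /= (bc_eq0 _ z2).2 ?subr0.
have [g gK] := choice surj.
by exists g => // x; apply: inj; rewrite gK.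
Qed.

End Sufficient.
End Criterion.

Lemma submod_separated (R1 R2 Rbar : pzRingType)
    (v1 : {rmorphism R1 -> Rbar}) (v2 : {rmorphism R2 -> Rbar})
    (v1_surj : surjective v1) (v2_surj : surjective v2)
    (M : lmodType (pullback_ring v1 v2)) (U : submodClosed M) :
  separated M -> separated (submod U).
Proof.
move=> sepM; apply: cap0_separated => // x x1 x2; apply: val_inj.
apply: separated_cap0 => //.
- exact: (ker_mul_linear (\val : {linear submod U -> M})).
- exact: (ker_mul_linear (\val : {linear submod U -> M})).
Qed.

Theorem corollary3p4 (R1 R2 Rbar : pzRingType)
    (v1 : {rmorphism R1 -> Rbar}) (v2 : {rmorphism R2 -> Rbar})
    (v1_surj : surjective v1) (v2_surj : surjective v2) :
  (forall (M : lmodType (pullback_ring v1 v2)) (U : submodClosed M),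
     separated M -> separated (submod U)) /\
  (forall (M N : lmodType (pullback_ring v1 v2)) (f : {linear M -> N}),
     (separated M -> separated (submod (ker_lin f))) /\
     (separated N -> separated (submod (im_lin f)))).
Proof.
split=> [M U|M N f]; first exact: submod_separated.
by split; exact: submod_separated.
Qed.
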